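(* Let $(X,\mathcal{U})$ be a compact uniform space and let $\varphi_{0,\infty}=\{\varphi_j\}_{j=0}^\infty$ be a sequence of upper semicontinuous maps $\varphi_j:X\to\mathcal{K}(X)$, $j\in\mathbb{N}\cup\{0\}$. Let $\varphi^*_{0,\infty}=\{\varphi_j^*\}_{j=0}^\infty$ be the sequence of induced single-valued hypermaps $\varphi_j^*:\mathcal{K}(X)\to\mathcal{K}(X)$, $\varphi_j^*(K)=\bigcup_{x\in K}\varphi_j(x)$. Then $$h_{\mathrm{H}}(\varphi_{0,\infty})\le h(\varphi^*_{0,\infty}).$$
   Context: $\mathcal{K}(X)$ is the set of nonempty compact subsets of $X$. A multivalued map $\varphi:X\to\mathcal{K}(X)$ is upper semicontinuous (u.s.c.) if $\{x\in X:\varphi(x)\subset B\}$ is open for every open $B\subset X$. Composition: $(\varphi_2\circ\varphi_1)(x)=\bigcup_{y\in\varphi_1(x)}\varphi_2(y)$; $\varphi^{[0]}=\mathrm{id}_X$ (i.e. $\varphi^{[0]}(x)=\{x\}$), $\varphi^{[k]}=\varphi_{k-1}\circ\dots\circ\varphi_0$ for $k>0$. For u.s.c. $\varphi_j:X\to\mathcal{K}(X)$ the sets $\varphi^{[k]}(x)$ are nonempty compact, and $\varphi_j^*$ maps $\mathcal{K}(X)$ into $\mathcal{K}(X)$ (possibly discontinuously). $\mathbb{N}=\{1,2,\dots\}$. Uniformities. A uniformity on a nonempty set $X$ is a family $\mathcal{U}$ of pseudometrics on $X$ such that: (U1) $p_0,p_1\in\mathcal{U}$ implies $\max\{p_0,p_1\}\in\mathcal{U}$;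 (U2) if $p$ is a pseudometric on $X$ such that for every $\varepsilon>0$ there are $q\in\mathcal{U}$, $\delta>0$ with $q(x,y)<\delta\Rightarrow p(x,y)<\varepsilon$ for all $x,y\in X$, then $p\in\mathcal{U}$; (U3) for $x\ne y$ there is $p\in\mathcal{U}$ with $p(x,y)>0$. The balls $B_p(x,r)=\{y: p(x,y)<r\}$, $p\in\mathcal{U}$, $x\in X$, $r>0$, form a base of a Hausdorff topology; $(X,\mathcal{U})$ is a compact uniform space if this topology is compact. A compact Hausdorff space carries a unique uniformity inducing its topology. For $p\in\mathcal{U}$ and $A,B\in\mathcal{K}(X)$ let $p^{\mathrm{H}}(A,B)=\max\{\sup_{a\in A}\inf_{b\in B}p(a,b),\sup_{b\in B}\inf_{a\in A}p(a,b)\}$. $\mathcal{K}(X)$ is endowed with the Vietoris topology; it is a compact Hausdorff space, and its topology (uniformity) is induced by the pseudometrics $p^{\mathrm{H}}$, $p\in\mathcal{U}$. $h_{\mathrm{H}}$: let $s_{\mathrm{H}}(\varphi_{0,\infty},p,\varepsilon,n)$ be the largest cardinality of a set $S\subset X$ such that for all distinct $x,y\in S$ there is $0\le k<n$ with $p^{\mathrm{H}}(\varphi^{[k]}(x),\varphi^{[k]}(y))>\varepsilon$. Then $h_{\mathrm{H}}(\varphi_{0,\infty})=\sup_{p\in\mathcal{U},\varepsilon>0}\limsup_n\frac1n\log s_{\mathrm{H}}(\varphi_{0,\infty},p,\varepsilon,n)$. (The same value is obtained with the least cardinality of $R\subset X$ such that for every $x\in X$ there is $y\in R$ with $p^{\mathrm{H}}(\varphi^{[k]}(x),\varphi^{[k]}(y))\le\varepsilon$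 for all $0\le k<n$.) Entropy $h$ of arbitrary single-valued maps: for a compact Hausdorff space $Y$ with its unique compatible uniformity $\mathcal{V}$ and a sequence $f_{0,\infty}$ of arbitrary (possibly discontinuous) single-valued maps $f_j:Y\to Y$, put $f^{[0]}=\mathrm{id}_Y$, $f^{[k]}=f_{k-1}\circ\dots\circ f_0$, let $s(f_{0,\infty},q,\varepsilon,n)$ be the largest cardinality of $S\subset Y$ such that $\max_{0\le k<n}q(f^{[k]}(x),f^{[k]}(y))>\varepsilon$ for all distinct $x,y\in S$, and $h(f_{0,\infty})=\sup_{q\in\mathcal{V},\varepsilon>0}\limsup_n\frac1n\log s(f_{0,\infty},q,\varepsilon,n)$. Here $Y=\mathcal{K}(X)$, $f_j=\varphi_j^*$. *)

(* Defs.v *)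
From HB Require Import structures.
From mathcomp Require Import all_boot all_order all_algebra finmap.
From mathcomp Require Import all_classical all_reals all_analysis.

Set Implicit Arguments.
Unset Strict Implicit.
Unset Printing Implicit Defensive.

Import Order.TTheory GRing.Theory Num.Theory.
Import numFieldNormedType.Exports.

Local Open Scope classical_set_scope.
Local Open Scope ring_scope.

(** ** Uniformities given by pseudometrics *)

Record pseudometric (R : realType) (X : Type) (p : X -> X -> R) : Prop := {
  pseudometric_ge0 : forall x y, 0 <= p x y;
  pseudometric_refl : forall x, p x x = 0;
  pseudometric_sym : forall x y, p x y = p y x;
  pseudometric_triangle : forall x y z, p x z <= p x y + p y z
}.

Record uniformity (R : realType) (X : Type) (U : set (X -> X -> R)) : Prop := {
  uniformity_pseudometric : forall p, U p -> pseudometric p;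
  uniformity_max : forall p0 p1, U p0 -> U p1 ->
    U (fun x y => Num.max (p0 x y) (p1 x y));
  uniformity_saturated : forall p, pseudometric p ->
    (forall e, 0 < e -> exists q delta, [/\ U q, 0 < delta &
       forall x y, q x y < delta -> p x y < e]) -> U p;
  uniformity_separated : forall x y, x <> y -> exists2 p, U p & 0 < p x y
}.

Definition pball (R : realType) (X : Type) (p : X -> X -> R) (x : X) (r : R) :
  set X := [set y | p x y < r].

Definition pballs (R : realType) (X : Type) (U : set (X -> X -> R)) :
  set (set X) :=
  [set B | exists p x r, [/\ U p, 0 < r & B = pball p x r]].

(* [U] is a uniformity on [X] whose topology is the one carried by [X].  The
   topology is then Hausdorff by [uniformity_separated]. *)
Definition compatible_uniformity (R : realType) (X : topologicalType)
  (U : set (X -> X -> R)) : Prop := uniformity U /\ basis (pballs U).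

Definition compact_uniform_space (R : realType) (X : topologicalType)
  (U : set (X -> X -> R)) : Prop :=
  [/\ [set: X] !=set0, compatible_uniformity U & compact [set: X]].

(** ** The hyperspace K(X) with the Vietoris topology *)

Record hyperspace (X : topologicalType) := Hyperspace {
  hset :> set X;
  hset_nonempty : hset !=set0;
  hset_compact : compact hset
}.

HB.instance Definition _ (X : topologicalType) := gen_eqMixin (hyperspace X).
HB.instance Definition _ (X : topologicalType) :=
  gen_choiceMixin (hyperspace X).

Definition vietoris_subbase (X : topologicalType) : set (set (hyperspace X)) :=
  [set W | exists2 B : set X, open B &
     W = [set K : hyperspace X | K `<=` B] \/
     W = [set K : hyperspace X | K `&` B !=set0]].

HB.instance Definition _ (X : topologicalType) :=
  isSubBaseTopological.Build (hyperspace X) (@vietoris_subbase X) id.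

(* Real-valued [sup] and [inf] are junk (0) on unbounded sets; no such set
   occurs when [A] and [B] are nonempty and compact and [p] is continuous. *)
Definition hausdorff_pseudometric (R : realType) (X : Type) (p : X -> X -> R)
  (A B : set X) : R :=
  Num.max (sup [set inf [set p a b | b in B] | a in A])
          (sup [set inf [set p a b | a in A] | b in B]).

(** ** Multivalued maps *)

Definition usc (X : topologicalType) (phi : X -> hyperspace X) : Prop :=
  forall B : set X, open B -> open [set x | phi x `<=` B].

Fixpoint multi_iter (X : topologicalType) (phi : nat -> X -> hyperspace X)
  (k : nat) (x : X) : set X :=
  if k is k'.+1 then \bigcup_(y in multi_iter phi k' x) phi k' y
  else [set x].

Lemma usc_bigcup_compact (X : topologicalType) (phi : X -> hyperspace X)
  (K : set X) : usc phi -> compact K -> compact (\bigcup_(x in K) phi x).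
Proof.
move=> uphi cK G PG GK.
pose H := filter_from G
  (fun W => [set x | K x /\ (phi x : set X) `&` W !=set0]).
have FH : ProperFilter H.
  apply: filter_from_proper; first apply: filter_from_filter.
  - by exists setT; exact: filterT.
  - move=> V W GV GW; exists (V `&` W); first exact: filterI.
    by move=> x [Kx [z [zx [Vz Wz]]]]; split; split => //; exists z.
  - move=> W GW; have [z [[x Kx zx] Wz]] := filter_ex (filterI GK GW).
    by exists x; split => //; exists z.
have [x [Kx clx]] : K `&` cluster H !=set0.
  by apply: cK; exists setT; [exact: filterT|move=> x []].
apply: contrapT => ncl.
have := @hset_compact _ (phi x) => /compact_near_coveringP.
move=> /(_ _ (powerset_filter_from G) (fun W z => nbhs z (~` W)) _).
case.
  move=> z zx; have : ~ cluster G z.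
    by move=> clz; apply: ncl; exists z; split => //; exists x.
  move=> /existsNP [W /existsNP [A /not_implyP [GW /not_implyP [nA WA0]]]].
  exists (interior A, [set V | G V /\ V `<=` W]).
    split => /=; first exact: nbhs_interior.
    exists [set V | G V /\ V `<=` W] => //=; split=> /=.
    - by move=> V /= [].
    - move=> V1 V2 /= [_ V1W] GV2 V21; split => //; exact: subset_trans V1W.
    - by exists W => /=; split.
  move=> [z' V] /= [Az' [GV VW]].
  apply: filterS Az' => y Ay Vy; apply: WA0; exists y; split => //.
  exact: VW.
move=> Q [QG _ [W QW]] QP.
have sub : phi x `<=` interior (~` W) by exact: QP.
have nx : nbhs x [set x' | phi x' `<=` interior (~` W)].
  apply: open_nbhs_nbhs; split => //.
  by apply: uphi; exact: open_interior.
have HW : H [set x' | K x' /\ (phi x' : set X) `&` W !=set0].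
  by exists W => //; exact: QG.
have [x' [[_ [z [zx' Wz]]] sx']] := clx _ _ HW nx.
exact: (interior_subset (sx' _ zx')).
Qed.

Definition hypermap (X : topologicalType) (phi : X -> hyperspace X)
  (uphi : usc phi) (K : hyperspace X) : hyperspace X.
Proof.
apply: (@Hyperspace X (\bigcup_(x in K) phi x)).
- have [x Kx] := hset_nonempty K; have [y yx] := hset_nonempty (phi x).
  by exists y, x.
- exact: usc_bigcup_compact uphi (@hset_compact X K).
Defined.

(** ** Entropies *)

(* [d k x y] is the distance between the [k]-th iterates of [x] and [y].  The
   value is +oo when there are arbitrarily large finite separated sets. *)
Definition sep_card (R : realType) (T : choiceType) (d : nat -> T -> T -> R)
  (e : R) (n : nat) : \bar R :=
  ereal_sup [set (#|` S|%:R)%:E | S in [set S : {fset T} |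
    forall x y, x \in S -> y \in S -> x <> y ->
      exists2 k, (k < n)%N & e < d k x y]].

Definition sep_growth (R : realType) (T : choiceType)
  (d : nat -> T -> T -> R) (e : R) : \bar R :=
  limn_esup (fun n => ((n%:R^-1)%:E * lne (sep_card d e n))%E).

Definition entropyH (R : realType) (X : topologicalType)
  (U : set (X -> X -> R)) (phi : nat -> X -> hyperspace X) : \bar R :=
  ereal_sup [set sep_growth (fun k x y =>
      hausdorff_pseudometric p (multi_iter phi k x) (multi_iter phi k y)) e
    | p in U & e in [set e : R | 0 < e]].

Fixpoint seq_iter (Y : Type) (f : nat -> Y -> Y) (k : nat) (y : Y) : Y :=
  if k is k'.+1 then f k' (seq_iter f k' y) else y.

Definition entropy (R : realType) (Y : choiceType) (V : set (Y -> Y -> R))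
  (f : nat -> Y -> Y) : \bar R :=
  ereal_sup [set sep_growth (fun k x y => q (seq_iter f k x) (seq_iter f k y)) e
    | q in V & e in [set e : R | 0 < e]].

(* Main.v *)
Require Import Defs.
From mathcomp Require Import all_boot all_order all_algebra.
From mathcomp Require Import all_classical all_reals all_analysis.
From mathcomp Require Import finmap lra.

(** The map [x |-> {x}] is an injection of [X] into [K(X)], and the [k]-th
    iterate of the induced hypermaps sends [{x}] to the set [phi^[k](x)].
    Measuring distances in [K(X)] by the Hausdorff pseudometric [p^H], a set
    which is separated for the multivalued maps is therefore carried to a set
    of singletons, of the same cardinality, which is separated for the
    hypermaps.  The inequality follows as soon as each [p^H], [p \in U], is one
    of the pseudometrics over which the entropy on [K(X)] is a supremum, i.e.
    as soon as it belongs to [V].  Continuity of the hypermaps plays no role.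

    The only thing known about [V] is that it is a uniformity inducing the
    Vietoris topology, so [p^H \in V] is deduced from three facts:
    [hyperspace_compact], [K(X)] is compact when [X] is;
    [hausdorff_is_pseudometric] and [hausdorff_nbhs], [p^H] is a pseudometric
    which is continuous for the Vietoris topology;
    [continuous_pseudometric_mem], on a compact space every continuous
    pseudometric belongs to every compatible uniformity (a Lebesgue number
    argument). *)

Set Implicit Arguments.
Unset Strict Implicit.
Unset Printing Implicit Defensive.

Import Order.TTheory GRing.Theory Num.Theory.

Local Open Scope classical_set_scope.
Local Open Scope ring_scope.

(** * The Vietoris topology and its compactness *)

(** The point [{x}] of the hyperspace. *)
Definition hyper1 (X : topologicalType) (x : X) : hyperspace X :=
  Hyperspace (ex_intro [set x] x erefl) (@compact_set1 _ x).

Lemma hyper1_inj (X : topologicalType) : injective (@hyper1 X).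
Proof.
by move=> x y xy; have : hset (hyper1 y) x by rewrite -xy.
Qed.

Section Vietoris.
Context {X : topologicalType}.

Lemma vietoris_subbase_open (W : set (hyperspace X)) :
  vietoris_subbase W -> open W.
Proof.
move=> VW; exists [set W]; last by rewrite bigcup_set1.
move=> _ ->; exists [fset W]%fset.
  by move=> i /fset1P ->; exact: mem_set.
by rewrite set_fset1 bigcap_set1.
Qed.

Lemma open_vietoris_subset (B : set X) :
  open B -> open [set K : hyperspace X | K `<=` B].
Proof. by move=> oB; apply: vietoris_subbase_open; exists B => //; left. Qed.

Lemma open_vietoris_meets (B : set X) :
  open B -> open [set K : hyperspace X | K `&` B !=set0].
Proof. by move=> oB; apply: vietoris_subbase_open; exists B => //; right. Qed.

(** Convergence to [L] need only be tested on the subbasic sets. *)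
Lemma vietoris_cvg (F : set_system (hyperspace X)) (L : hyperspace X) :
  Filter F ->
  (forall B : set X, open B -> L `<=` B -> F [set K | K `<=` B]) ->
  (forall B : set X, open B -> L `&` B !=set0 -> F [set K | K `&` B !=set0]) ->
  F --> L.
Proof.
move=> FF Fsub Fmeet A [B [[D' D'sub <-] [W D'W WL]] DA].
apply: filterS DA _; apply: (@filterS _ _ _ W); first by move=> K WK; exists W.
have [D Dsub WE] := D'sub _ D'W.
rewrite -WE in WL *; apply: filter_bigI => V DV.
have /set_mem [C oC VE] := Dsub _ DV.
have VL : V L by exact: WL.
by case: VE VL => -> ?; [exact: Fsub|exact: Fmeet].
Qed.

(** An ultrafilter [F] on the hyperspace converges to the set [L] of the points
    all of whose open neighbourhoods meet [F]-almost every compact set. *)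
Lemma hyperspace_compact : compact [set: X] -> compact [set: hyperspace X].
Proof.
move=> cX; rewrite compact_ultra => F UF _.
pose L := [set x | forall B : set X, open B -> B x ->
  F [set K : hyperspace X | K `&` B !=set0]].
(* Here [F] being an ultrafilter matters: not almost always meeting [B] means
   almost always missing it. *)
have missL x : ~ L x -> exists B : set X,
    [/\ open B, B x & F [set K : hyperspace X | ~ (K `&` B !=set0)]].
  move=> /existsNP [B /not_implyP [oB /not_implyP [Bx nF]]].
  exists B; split => //.
  by have [|] := in_ultra_setVsetC [set K : hyperspace X | K `&` B !=set0] UF.
(* By compactness, a closed set disjoint from [L] is missed by almost every
   compact set. *)
have awayL (C : set X) : closed C -> C `&` L = set0 ->
    F [set K : hyperspace X | C `<=` ~` K].
  move=> clC CL0.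
  have /compact_near_coveringP : compact C by exact: subclosed_compact cX _.
  apply => x Cx; have /missL [B [oB Bx FB]] : ~ L x.
    by move=> Lx; have : (C `&` L) x by []; rewrite CL0.
  exists (B, [set K : hyperspace X | ~ (K `&` B !=set0)]).
    by split => //; exact: open_nbhs_nbhs.
  by move=> [x' K] [/= Bx' KB] Kx'; apply: KB; exists x'.
have clL : closed L.
  rewrite -openC openE => x /missL [B [oB Bx FB]].
  rewrite /interior nbhsE; exists B => // y By Ly.
  by have [K [KB nKB]] := filter_ex (filterI (Ly _ oB By) FB).
have L0 : L !=set0.
  apply: contrapT => /set0P/negP/negPn/eqP L0.
  have := awayL setT closedT; rewrite L0 setI0 => /(_ erefl) FT.
  have [K TK] := filter_ex FT; have [x Kx] := hset_nonempty K.
  exact: (TK x).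
have cL : compact L by exact: subclosed_compact cX _.
exists (Hyperspace L0 cL); split => //; apply: vietoris_cvg => B oB /=.
- move=> LB; have : F [set K : hyperspace X | ~` B `<=` ~` K].
    apply: awayL; first by rewrite closedC.
    by apply/seteqP; split => x // [nBx /LB].
  by apply: filterS => K BK y Ky; apply: contrapT => /BK.
- by move=> [x [Lx Bx]]; exact: Lx.
Qed.

End Vietoris.

(** * The Hausdorff pseudometric *)

Section Hausdorff.
Context {R : realType} {X : Type} (p : X -> X -> R).
Hypothesis p_ge0 : forall x y, 0 <= p x y.
Implicit Types (A B : set X) (r M : R).

Lemma hausdorff_le A B r : A !=set0 -> B !=set0 ->
  (forall a, A a -> exists2 b, B b & p a b <= r) ->
  (forall b, B b -> exists2 a, A a & p a b <= r) ->
  hausdorff_pseudometric p A B <= r.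
Proof.
move=> A0 B0 AB BA; rewrite ge_max; apply/andP; split; apply: ge_sup.
- by have [a Aa] := A0; exists (inf [set p a b | b in B]), a.
- move=> _ [a Aa <-]; have [b Bb pab] := AB _ Aa.
  apply: le_trans pab; apply: ge_inf; last by exists b.
  by exists 0 => _ [? _ <-].
- by have [b Bb] := B0; exists (inf [set p a b | a in A]), b.
- move=> _ [b Bb <-]; have [a Aa pab] := BA _ Bb.
  apply: le_trans pab; apply: ge_inf; last by exists a.
  by exists 0 => _ [? _ <-].
Qed.

Context (M : R).
Hypothesis p_leM : forall x y, p x y <= M.

(** The upper bound [M] on [p] keeps the supremum in the Hausdorff pseudometric
    from taking its default value. *)
Lemma hausdorff_lt_l A B r a : B !=set0 ->
  hausdorff_pseudometric p A B < r -> A a -> exists2 b, B b & p a b < r.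
Proof.
move=> [b0 Bb0]; rewrite gt_max => /andP[supr _] Aa.
have infr : inf [set p a b | b in B] < r.
  apply: le_lt_trans supr; apply: ub_le_sup; last by exists a.
  exists M => _ [c _ <-]; apply: le_trans (p_leM c b0).
  by apply: ge_inf; [exists 0 => _ [? _ <-]|exists b0].
have [||_ [b Bb <-]] := @inf_adherent _ [set p a b | b in B]
    (r - inf [set p a b | b in B]).
- by rewrite subr_gt0.
- by split; [exists (p a b0), b0|exists 0 => _ [? _ <-]].
- by rewrite addrC subrK => pr; exists b.
Qed.

End Hausdorff.

Lemma hausdorff_transpose (R : realType) (X : Type) (p : X -> X -> R)
  (A B : set X) :
  hausdorff_pseudometric p A B = hausdorff_pseudometric (fun x y => p y x) B A.
Proof. exact: maxC. Qed.

Lemma hausdorff_lt_r (R : realType) (X : Type) (p : X -> X -> R) (M : R)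
  (p_ge0 : forall x y, 0 <= p x y) (p_leM : forall x y, p x y <= M)
  (A B : set X) (r : R) (b : X) : A !=set0 ->
  hausdorff_pseudometric p A B < r -> B b -> exists2 a, A a & p a b < r.
Proof.
rewrite hausdorff_transpose; apply: (@hausdorff_lt_l _ _ (fun x y => p y x)).
- by move=> x y; exact: p_ge0.
- by move=> x y; exact: p_leM.
Qed.

Lemma hausdorff_is_pseudometric (R : realType) (X : topologicalType)
  (p : X -> X -> R) (M : R) :
  pseudometric p -> (forall x y, p x y <= M) ->
  pseudometric (fun K L : hyperspace X => hausdorff_pseudometric p K L).
Proof.
move=> [p0 pxx psym ptri] pM.
have le_sym (K L : hyperspace X) :
    hausdorff_pseudometric p K L <= hausdorff_pseudometric p L K.
  apply/ler_addgt0Pr => e e0.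
  have lt_e : hausdorff_pseudometric p L K < hausdorff_pseudometric p L K + e.
    by rewrite ltrDl.
  apply: hausdorff_le => //; [exact: hset_nonempty|exact: hset_nonempty| |].
  - move=> a Ka.
    have [b Lb pba] := hausdorff_lt_r p0 pM (hset_nonempty L) lt_e Ka.
    by exists b => //; rewrite psym ltW.
  - move=> b Lb.
    have [a Ka pba] := hausdorff_lt_l p0 pM (hset_nonempty K) lt_e Lb.
    by exists a => //; rewrite psym ltW.
split.
- move=> K L; rewrite leNgt; apply/negP => neg.
  have [a Ka] := hset_nonempty K.
  have [b _] := hausdorff_lt_l p0 pM (hset_nonempty L) neg Ka.
  by rewrite ltNge p0.
- move=> K; apply/eqP; rewrite eq_le; apply/andP; split.
    apply: hausdorff_le => //; [exact: hset_nonempty|exact: hset_nonempty| |];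
    by move=> a Ka; exists a => //; rewrite pxx.
  rewrite leNgt; apply/negP => neg; have [a Ka] := hset_nonempty K.
  have [b _] := hausdorff_lt_l p0 pM (hset_nonempty K) neg Ka.
  by rewrite ltNge p0.
- by move=> K L; apply/eqP; rewrite eq_le !le_sym.
- move=> K L N; apply/ler_addgt0Pr => e e0.
  have lt_KL : hausdorff_pseudometric p K L <
    hausdorff_pseudometric p K L + e / 2 by rewrite ltrDl divr_gt0.
  have lt_LN : hausdorff_pseudometric p L N <
    hausdorff_pseudometric p L N + e / 2 by rewrite ltrDl divr_gt0.
  apply: hausdorff_le => //; [exact: hset_nonempty|exact: hset_nonempty| |].
  + move=> a Ka.
    have [b Lb pab] := hausdorff_lt_l p0 pM (hset_nonempty L) lt_KL Ka.
    have [c Nc pbc] := hausdorff_lt_l p0 pM (hset_nonempty N) lt_LN Lb.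
    by exists c => //; have := ptri a b c; lra.
  + move=> c Nc.
    have [b Lb pbc] := hausdorff_lt_r p0 pM (hset_nonempty L) lt_LN Nc.
    have [a Ka pab] := hausdorff_lt_r p0 pM (hset_nonempty K) lt_KL Lb.
    by exists a => //; have := ptri a b c; lra.
Qed.

(** * Uniformities on compact spaces *)

Lemma pball_center (R : realType) (X : Type) (p : X -> X -> R) x (r : R) :
  pseudometric p -> 0 < r -> pball p x r x.
Proof. by move=> pp r0; rewrite /pball /= pseudometric_refl. Qed.

Section CompatibleUniformity.
Context {R : realType} {X : topologicalType} {U : set (X -> X -> R)}.
Hypothesis hU : compatible_uniformity U.

Lemma open_pball p x r : U p -> 0 < r -> open (pball p x r).
Proof. by move=> Up r0; have [_ [+ _]] := hU; apply; exists p, x, r. Qed.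

Lemma pball_nbhs p x r : U p -> 0 < r -> nbhs x (pball p x r).
Proof.
move=> Up r0; apply: open_nbhs_nbhs; split; first exact: open_pball.
by apply: pball_center => //; exact: uniformity_pseudometric hU.1 _ Up.
Qed.

Lemma nbhs_pball x (A : set X) : nbhs x A ->
  exists p r, [/\ U p, 0 < r & pball p x r `<=` A].
Proof.
move=> /(hU.2.2 x) [B [[p [y [r [Up r0 ->]]]]] yx BA].
exists p, (r - p y x); split => //; first by rewrite subr_gt0.
move=> z xz; apply: BA; rewrite /pball /= in xz *.
have [_ _ _ tri] := uniformity_pseudometric hU.1 Up.
by have := tri y x z; lra.
Qed.

Lemma compact_pseudometric_bounded p : compact [set: X] -> U p ->
  exists M, forall x y, p x y <= M.
Proof.
move=> cX Up.
have [p0 _ psym tri] := uniformity_pseudometric hU.1 Up.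
have [[x0 _]|nX] := pselect ([set: X] !=set0); last first.
  by exists 0 => x; case: nX; exists x.
(* A bound on the distances to one point [x0]. *)
have : \forall M \near +oo, [set: X] `<=` [set y | p x0 y < M].
  have /compact_near_coveringP := cX; apply => y _.
  exists (pball p y 1, [set M | p x0 y + 1 < M]).
    by split => /=; [exact: pball_nbhs|apply: nbhs_pinfty_gt; exact: num_real].
  move=> [y' M] [/= yy' ltM]; rewrite /pball /= in yy'.
  by have := tri x0 y y'; lra.
move=> /filter_ex [M ltM]; exists (M + M) => x y.
have := tri x x0 y; rewrite (psym x x0).
by have := ltM x I; have := ltM y I; rewrite /=; lra.
Qed.

(** On a nonempty compact space, a compatible uniformity contains every
    continuous pseudometric. *)
Lemma continuous_pseudometric_mem (q : X -> X -> R) :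
  compact [set: X] -> [set: X] !=set0 -> pseudometric q ->
  (forall x e, 0 < e -> nbhs x (pball q x e)) -> U q.
Proof.
move=> cX [x0 _] pq qnbhs; have [_ _ qsym qtri] := pq.
apply: (uniformity_saturated hU.1) => // e e0.
(* [G] is the filter of the pairs [(p, d)] whose entourage [p x y < d] is small
   enough; compactness turns a choice of such pairs at each point into a
   choice valid at all points. *)
pose G := filter_from [set i : (X -> X -> R) * R | U i.1 /\ 0 < i.2]
  (fun i => [set j | [/\ U j.1, 0 < j.2 &
     forall x y, j.1 x y < j.2 -> i.1 x y < i.2]]).
have FG : Filter G.
  apply: filter_from_filter.
    have [p [r [Up r0 _]]] := nbhs_pball (@filterT _ (nbhs x0) _).
    by exists (p, r).
  move=> [p d] [p' d'] /= [Up d0] [Up' d0'].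
  exists (fun x y => Num.max (p x y) (p' x y), Num.min d d') => /=.
    by split; [exact: uniformity_max hU.1 _ _ Up Up'|rewrite lt_min d0].
  move=> [q' r] /= [Uq' r0 H]; split; split => // x y /H;
  by rewrite gt_max !lt_min => /andP[/andP[? ?] /andP[? ?]].
have : \forall i \near G, [set: X] `<=`
    [set x | forall y, i.1 x y < i.2 -> q x y < e].
  have /compact_near_coveringP := cX; apply => x _.
  have e20 : 0 < e / 2 by rewrite divr_gt0.
  have [p [r [Up r0 pq2]]] := nbhs_pball (qnbhs x _ e20).
  have [_ _ _ ptri] := uniformity_pseudometric hU.1 Up.
  have r20 : 0 < r / 2 by rewrite divr_gt0.
  exists (pball p x (r / 2), [set j | [/\ U j.1, 0 < j.2 &
      forall x y, j.1 x y < j.2 -> p x y < r / 2]]) => /=.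
    by split => /=; [exact: pball_nbhs|exists (p, r / 2)].
  move=> [x' j] /= [xx' [_ _ H]] y /H px'y.
  have qxx' : pball q x (e / 2) x'.
    by apply: pq2; rewrite /pball /= in xx' *; lra.
  have qxy : pball q x (e / 2) y.
    by apply: pq2; rewrite /pball /= in xx' *; have := ptri x x' y; lra.
  have := qtri x' x y; rewrite /pball /= in qxx' qxy; rewrite (qsym x' x); lra.
move=> [[p d] /= [Up d0] sub]; exists p, d; split => // x y.
exact: (sub (p, d) _ x I y).
Qed.

(** Continuity of the Hausdorff pseudometric for the Vietoris topology. *)
Lemma hausdorff_nbhs p (K : hyperspace X) e : compact [set: X] -> U p ->
  0 < e -> nbhs K (pball (fun K L : hyperspace X =>
    hausdorff_pseudometric p K L) K e).
Proof.
move=> cX Up e0.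
have [p0 pxx psym tri] := uniformity_pseudometric hU.1 Up.
have e20 : 0 < e / 2 by rewrite divr_gt0.
have e40 : 0 < e / 4 by rewrite divr_gt0.
have nearK : \forall L \near K,
    hset K `<=` [set a | exists2 b, hset L b & p a b < e / 2].
  have /compact_near_coveringP cK := @hset_compact _ K.
  apply: (cK _ (nbhs K)
    (fun (L : hyperspace X) a => exists2 b, hset L b & p a b < e / 2)) => a Ka.
  exists (pball p a (e / 4),
    [set L : hyperspace X | L `&` pball p a (e / 4) !=set0]).
    split => /=; first exact: pball_nbhs.
    apply: open_nbhs_nbhs; split.
      by apply: open_vietoris_meets; exact: open_pball.
    by exists a; split => //; apply: pball_center.
  move=> [a' L] [/= aa' [b [Lb ab]]]; exists b => //.
  rewrite /pball /= in aa' ab.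
  by have := tri a' a b; rewrite (psym a' a); lra.
have nearL : \forall L \near K,
    hset L `<=` \bigcup_(a in K) pball p a (e / 2).
  apply: open_nbhs_nbhs; split.
    apply: open_vietoris_subset; apply: bigcup_open => a _; exact: open_pball.
  by move=> a Ka; exists a => //; apply: pball_center.
apply: filterS2 nearK nearL => L KL LK.
rewrite /pball /=; apply: (@le_lt_trans _ _ (e / 2)); last by lra.
apply: hausdorff_le => //; [exact: hset_nonempty|exact: hset_nonempty| |].
- by move=> a /KL [b Lb pab]; exists b => //; exact: ltW.
- by move=> b /LK [a Ka pab]; exists a => //; exact: ltW.
Qed.

End CompatibleUniformity.

Lemma hausdorff_mem_uniformity (R : realType) (X : topologicalType)
  (U : set (X -> X -> R)) (V : set (hyperspace X -> hyperspace X -> R)) p :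
  compact_uniform_space U -> compatible_uniformity V -> U p ->
  V (fun K L : hyperspace X => hausdorff_pseudometric p K L).
Proof.
move=> [[x _] hU cX] hV Up; apply: (continuous_pseudometric_mem hV).
- exact: hyperspace_compact.
- by exists (hyper1 x).
- have [M pM] := compact_pseudometric_bounded hU cX Up.
  exact: hausdorff_is_pseudometric (uniformity_pseudometric hU.1 Up) pM.
- by move=> K e; exact: hausdorff_nbhs hU _ _ _ cX Up.
Qed.

(** * Comparison of separated sets *)

Section Separated.
Context {R : realType}.

Lemma sep_card_le (T T' : choiceType) (f : T -> T') (d : nat -> T -> T -> R)
  (d' : nat -> T' -> T' -> R) e n : injective f ->
  (forall k x y, d k x y = d' k (f x) (f y)) ->
  (sep_card d e n <= sep_card d' e n)%E.
Proof.
move=> injf dd'; apply: ge_ereal_sup => _ [S sepS <-].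
apply: ereal_sup_ubound; exists [fset f x | x in S]%fset.
  move=> _ _ /imfsetP [x /= xS ->] /imfsetP [y /= yS ->] fxy.
  have [|k kn lt_e] := sepS x y xS yS; first by move=> xy; rewrite xy in fxy.
  by exists k => //; rewrite -dd'.
by rewrite card_imfset.
Qed.

Lemma sep_card_ge0 (T : choiceType) (d : nat -> T -> T -> R) e n :
  (0 <= sep_card d e n)%E.
Proof.
apply: ereal_sup_ubound; exists fset0; last by rewrite cardfs0.
by move=> x y; rewrite in_fset0.
Qed.

Lemma limn_esup_le (u v : (\bar R)^nat) : (forall n, u n <= v n)%E ->
  (limn_esup u <= limn_esup v)%E.
Proof.
move=> uv; rewrite /limn_esup !limf_esupE.
apply: le_ereal_inf_tmp => _ [A FA <-].
apply: (@le_trans _ _ (ereal_sup [set u n | n in A])).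
  by apply: ereal_inf_lbound; exists A.
apply: ge_ereal_sup => _ [n An <-]; apply: le_trans (uv n) _.
by apply: ereal_sup_ubound; exists n.
Qed.

Lemma sep_growth_le (T T' : choiceType) (f : T -> T') (d : nat -> T -> T -> R)
  (d' : nat -> T' -> T' -> R) e : injective f ->
  (forall k x y, d k x y = d' k (f x) (f y)) ->
  (sep_growth d e <= sep_growth d' e)%E.
Proof.
move=> injf dd'; apply: limn_esup_le => n.
apply: lee_wpmul2l; first by rewrite lee_fin invr_ge0.
by rewrite lee_lne ?in_itv /= ?sep_card_ge0 ?leey //; exact: sep_card_le injf _.
Qed.

End Separated.

(** * The orbits of singletons *)

Lemma hypermap_iter1 (X : topologicalType) (phi : nat -> X -> hyperspace X)
  (uphi : forall j, usc (phi j)) k x :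
  seq_iter (fun j => hypermap (uphi j)) k (hyper1 x) = multi_iter phi k x
    :> set X.
Proof. by elim: k => //= k ->. Qed.

(* [V] is the uniformity of the compact Hausdorff space K(X). *)
Theorem proposition5p1 (R : realType) (X : topologicalType)
  (U : set (X -> X -> R)) (hU : compact_uniform_space U)
  (phi : nat -> X -> hyperspace X) (uphi : forall j, usc (phi j))
  (V : set (hyperspace X -> hyperspace X -> R))
  (hV : compatible_uniformity V) :
  (entropyH U phi <= entropy V (fun j => hypermap (uphi j)))%E.
Proof.
apply: ge_ereal_sup => _ [p Up [e e0 <-]].
pose pH (K L : hyperspace X) := hausdorff_pseudometric p K L.
apply: (@le_trans _ _ (sep_growth (fun k K L =>
  pH (seq_iter (fun j => hypermap (uphi j)) k K)
     (seq_iter (fun j => hypermap (uphi j)) k L)) e)); last first.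
  apply: ereal_sup_ubound; exists pH; last by exists e.
  exact: hausdorff_mem_uniformity hU hV Up.
apply: (sep_growth_le (f := @hyper1 X)) => [|k x y]; first exact: hyper1_inj.
by rewrite /pH !hypermap_iter1.
Qed.
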